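(* (1) For every $d_1\ge 0$ there exists $c>0$ such that, with high probability, $G_n\sim G(n,d_1/n)$ is monotone $c$-tiny. (2) For every $c>0$ there exists $d_2\ge 0$ such that, with high probability, $G_n\sim G(n,d_2/n)$ is not monotone $c$-tiny.
   Context: $G(n,p)$ is the Erdős–Rényi random graph on vertex set $[n]$ in which each of the $\binom n2$ possible edges is present independently with probability $p$. An event holds with high probability (w.h.p.) if its probability tends to 1 as $n\to\infty$. For a graph $G$ and $k\ge1$, $s_k(G)$ denotes the number of unlabeled (i.e., isomorphism classes of) $k$-vertex subgraphs (not necessarily induced) of $G$. For a constant $c$, an $n$-vertex graph $G$ is monotone $c$-tiny if $s_k(G)\le c^k$ for every $k\in\{1,\dots,n\}$. *)

(* Defs.v *)
From HB Require Import structures.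
From mathcomp Require Import all_boot all_order perm all_algebra.
From mathcomp Require Import reals.
Set Implicit Arguments. Unset Strict Implicit. Unset Printing Implicit Defensive.
Import Order.TTheory GRing.Theory Num.Theory.
Local Open Scope ring_scope.

Definition pairs (n : nat) : {set {set 'I_n}} := [set e : {set 'I_n} | #|e| == 2%N].

Definition is_graph (n : nat) (E : {set {set 'I_n}}) : bool := E \subset pairs n.

Definition graph_iso (k : nat) (E1 E2 : {set {set 'I_k}}) : bool :=
  [exists s : {perm 'I_k}, [set [set s x | x in e] | e : {set 'I_k} in E1] == E2].

Definition embeds (k n : nat) (H : {set {set 'I_k}}) (G : {set {set 'I_n}}) : bool :=
  [exists f : {ffun 'I_k -> 'I_n}, injectiveb f && [forall e : {set 'I_k} in H, [set f x | x in e] \in G]].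

Definition sub_graphs (k n : nat) (G : {set {set 'I_n}}) : {set {set {set 'I_k}}} :=
  [set H : {set {set 'I_k}} | is_graph H && embeds H G].

Definition s_k (k n : nat) (G : {set {set 'I_n}}) : nat :=
  #|[set [set H' in sub_graphs k G | graph_iso H H'] | H in sub_graphs k G]|.

Definition monotone_tiny (R : realType) (c : R) (n : nat) (G : {set {set 'I_n}}) : bool :=
  all (fun k : nat => (s_k k G)%:R <= c ^+ k) (iota 1 n).

Definition gnp_prob (R : realType) (n : nat) (p : R) (P : pred {set {set 'I_n}}) : R :=
  \sum_(E : {set {set 'I_n}} | is_graph E && P E)
     p ^+ #|E| * (1 - p) ^+ (#|pairs n| - #|E|).

Definition whp (R : realType) (d : R) (P : forall n : nat, pred {set {set 'I_n}}) : Prop :=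
  forall eps : R, 0 < eps -> exists N : nat, forall n : nat, (N <= n)%N ->
    `|gnp_prob (d / n%:R) (P n) - 1| < eps.

(* Main.v *)
Require Import Defs.
From HB Require Import structures.
From mathcomp Require Import all_boot all_order perm all_algebra.
From mathcomp Require Import reals.
From mathcomp Require Import boolp sequences exp.
From mathcomp Require Import zify ring lra.
Set Implicit Arguments. Unset Strict Implicit. Unset Printing Implicit Defensive.
Import Order.TTheory GRing.Theory Num.Theory.
Local Open Scope nat_scope.

(** Upper bound. Listing a component with j vertices in breadth-first order
    presents it as one of at most 4^j search trees together with a set of extra
    edges.  With at most one extra edge there are only exponentially many such
    patterns altogether.  With r >= 2 extra edges, a pattern has at most n^j
    placements in G(n, d/n), each of probability (d/n)^(j-1+r), so the expected
    number of patterns of this kind that occur is at most C^j / n, uniformly in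
    j <= n.  By Markov's inequality, with high probability at most exponentially
    many j-vertex patterns occur for every j, and s_k is then bounded by splitting
    off one component at a time.

    Lower bound. If d is large, then with high probability any two disjoint
    vertex sets of size t = n/q are joined by an edge.  Depth-first search gives
    a path on k >= n - 2t vertices, and the graph H induced on it has at least
    k D / 4 edges with D of order q.  Consider the 2^(e(H) - k) graphs between
    the path and H.  An isomorphism between two of them moves the path to a
    Hamiltonian path of H, of which there are at most k prod (deg + 1) <=
    2^(3k + e(H)/2), so the number of isomorphism classes is exponential in k
    with a rate that grows with D. *)

(** * First moments in G(n, p) *)

Section RandomGraph.
Variable R : realType.
Local Open Scope ring_scope.

(** Expand the product of [p + q] over [U :\: A]: choosing [p] puts an element into [E], choosing
    [q] leaves it out. *)
Lemma sum_interval (T : finType) (A U : {set T}) (p q : R) : A \subset U ->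
  \sum_(E : {set T} | (A \subset E) && (E \subset U))
     p ^+ #|E :\: A| * q ^+ #|U :\: E| = (p + q) ^+ #|U :\: A|.
Proof.
move=> sAU.
(* [F e] and [G e] weigh [e] inside and outside [E]; their zeros kill every [E] that does not lie
   between [A] and [U]. *)
pose F e : R := if e \in A then 1 else if e \in U then p else 0.
pose G e : R := if e \in A then 0 else if e \in U then q else 1.
have prodC (D : {set T}) (x : R) (h : T -> R) :
    (forall e, h e = if e \in D then x else 1) -> \prod_e h e = x ^+ #|D|.
  move=> hE; under eq_bigr do rewrite hE.
  by rewrite -big_mkcond prodr_const.
have <- : \prod_e (F e + G e) = (p + q) ^+ #|U :\: A|.
  apply: prodC => e; rewrite /F /G !inE.
  by case: (e \in A); case: (e \in U) => /=; rewrite ?addr0 ?add0r.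
rewrite bigA_distr [RHS](bigID (fun E : {set T} => (A \subset E) && (E \subset U))) /=.
rewrite [X in _ = _ + X]big1 ?addr0; last first.
  move=> E; rewrite negb_and => /orP[] /subsetPn[e ein eout].
    by rewrite (bigD1 e) //= (negbTE eout) /G ein mul0r.
  have eA : e \notin A by apply: contra eout => /(subsetP sAU).
  by rewrite (bigD1 e) //= ein /F (negbTE eA) (negbTE eout) mul0r.
apply: eq_bigr => E /andP[sAE sEU].
rewrite -(prodC _ _ (fun e => if e \in E :\: A then p else 1)) //.
rewrite -(prodC _ _ (fun e => if e \in U :\: E then q else 1)) //.
rewrite -big_split /=; apply: eq_bigr => e _; rewrite /F /G !inE.
have := subsetP sAE e; have := subsetP sEU e.
case: (e \in A); case: (e \in E); case: (e \in U) => //= h1 h2;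
  rewrite ?mulr1 ?mul1r //; by [have := h1 isT | have := h2 isT].
Qed.

Definition gnp_mean n (p : R) (X : {set {set 'I_n}} -> R) : R :=
  \sum_(E : {set {set 'I_n}} | is_graph E)
     X E * (p ^+ #|E| * (1 - p) ^+ (#|pairs n| - #|E|)).

Lemma gnp_mean_prob n (p : R) (P : pred {set {set 'I_n}}) :
  gnp_prob p P = gnp_mean p (fun E => (P E)%:R).
Proof.
rewrite /gnp_prob /gnp_mean big_mkcondr; apply: eq_bigr => E _.
by case: (P E); rewrite ?mul1r ?mul0r.
Qed.

Lemma gnp_prob_superset n (p : R) (F : {set {set 'I_n}}) : is_graph F ->
  gnp_prob p (fun E => F \subset E) = p ^+ #|F|.
Proof.
move=> gF; rewrite /gnp_prob.
transitivity (p ^+ #|F| * \sum_(E : {set {set 'I_n}} | (F \subset E) && (E \subset pairs n))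
   p ^+ #|E :\: F| * (1 - p) ^+ #|pairs n :\: E|); last first.
  by rewrite sum_interval // subrKC expr1n mulr1.
rewrite big_distrr; apply: eq_big => [E|E /andP[gE sFE]]; first by rewrite andbC.
rewrite /= mulrA -exprD -(cardsDS gE); congr (_ ^+ _ * _).
by rewrite -(cardsID F E) (setIidPr sFE).
Qed.

Lemma gnp_prob_disjoint n (p : R) (F : {set {set 'I_n}}) : is_graph F ->
  gnp_prob p (fun E => [disjoint E & F]) = (1 - p) ^+ #|F|.
Proof.
move=> gF; rewrite /gnp_prob.
transitivity ((1 - p) ^+ #|F| * \sum_(E : {set {set 'I_n}} | (set0 \subset E) && (E \subset pairs n :\: F))
   p ^+ #|E :\: set0| * (1 - p) ^+ #|(pairs n :\: F) :\: E|); last first.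
  by rewrite sum_interval ?sub0set // subrKC expr1n mulr1.
rewrite big_distrr; apply: eq_big => [E|E /andP[gE dEF]].
  by rewrite sub0set subsetD.
rewrite setD0 /= mulrCA -exprD; congr (_ * _ ^+ _).
rewrite -(cardsDS gE) -(cardsID F (pairs n :\: E)) setDDl setUC -setDDl.
have -> : (pairs n :\: E) :&: F = F by apply/setIidPr; rewrite subsetD -/(is_graph F) gF disjoint_sym.
by rewrite ?setDDl 1?setUC.
Qed.

Lemma gnp_total n (p : R) : @gnp_prob R n p predT = 1.
Proof.
rewrite -(expr0 p) -(cards0 {set 'I_n}) -gnp_prob_superset ?/is_graph ?sub0set //.
by rewrite /gnp_prob; apply: eq_bigl => E; rewrite sub0set.
Qed.

Lemma gnp_mean_le n (p : R) (X Y : {set {set 'I_n}} -> R) : 0 <= p <= 1 ->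
  (forall E, is_graph E -> X E <= Y E) -> gnp_mean p X <= gnp_mean p Y.
Proof.
move=> /andP[p0 p1] XY; apply: ler_sum => E gE; apply: ler_wpM2r; last exact: XY.
by rewrite mulr_ge0 ?exprn_ge0 ?subr_ge0.
Qed.

Lemma gnp_mean_sum n (p : R) (I : Type) (r : seq I) (Q : pred I) (X : I -> {set {set 'I_n}} -> R) :
  gnp_mean p (fun E => \sum_(i <- r | Q i) X i E) = \sum_(i <- r | Q i) gnp_mean p (X i).
Proof. by rewrite exchange_big; apply: eq_bigr => E _; rewrite big_distrl. Qed.

Lemma gnp_meanZ n (p c : R) (X : {set {set 'I_n}} -> R) :
  gnp_mean p (fun E => c * X E) = c * gnp_mean p X.
Proof. by rewrite /gnp_mean big_distrr; apply: eq_bigr => E _; rewrite -mulrA. Qed.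

(** Markov's inequality: [X] is nonnegative and at least 1 where [P] fails, so its mean bounds the
    failure probability. The condition [d <= n%:R] makes [d / n%:R] a probability. *)
Lemma whp_of_mean (d : R) (P : forall n, pred {set {set 'I_n}})
    (X : forall n, {set {set 'I_n}} -> R) (N0 : nat) (b : nat -> R) :
  0 <= d ->
  (forall n (E : {set {set 'I_n}}), (N0 <= n)%N -> is_graph E -> ~~ P n E -> 1 <= X n E) ->
  (forall n (E : {set {set 'I_n}}), 0 <= X n E) ->
  (forall n, (N0 <= n)%N -> d <= n%:R -> gnp_mean (d / n%:R) (X n) <= b n) ->
  (forall eps, 0 < eps -> exists N, forall n, (N <= n)%N -> b n < eps) ->
  whp d P.
Proof.
move=> d0 PX X0 Xb blim eps eps0; have [N hN] := blim _ eps0.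
exists (maxn N0 (maxn N (Num.bound d).+1)) => n; rewrite !geq_max => /and3P[n0 nN nd].
have dn : d <= n%:R.
  by apply: ltW; apply: (lt_trans (archi_boundP d0)); rewrite ltr_nat.
have n_gt0 : 0 < n%:R :> R by rewrite ltr0n; apply: leq_trans nd.
have p01 : 0 <= d / n%:R <= 1.
  by rewrite divr_ge0 ?(ltW n_gt0) //= ler_pdivrMr // mul1r.
set p := d / n%:R in p01 *.
have -> : gnp_prob p (P n) - 1 = - gnp_mean p (fun E => (~~ P n E)%:R).
  rewrite -[X in _ - X](gnp_total n p) !gnp_mean_prob /gnp_mean -sumrB -sumrN.
  apply: eq_bigr => E _; rewrite -mulrBl -[RHS]mulNr; congr (_ * _).
  by case: (P n E); rewrite /= ?subrr ?oppr0 ?sub0r.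
have m0 : 0 <= gnp_mean p (fun E => (~~ P n E)%:R).
  apply: le_trans (gnp_mean_le p01 (X := fun=> 0) _); last by move=> *; rewrite ler0n.
  by rewrite /gnp_mean big1 // => *; rewrite mul0r.
rewrite normrN ger0_norm //.
apply: le_lt_trans (hN _ nN); apply: le_trans (Xb _ n0 dn).
apply: gnp_mean_le => // E gE; case: (boolP (P n E)) => [_|nP] //=; exact: PX.
Qed.

End RandomGraph.

(** * Codes of subgraphs *)

Lemma graph_isoP k (E1 E2 : {set {set 'I_k}}) :
  reflect (exists s : {perm 'I_k}, [set s @: e | e : {set 'I_k} in E1] = E2)
          (graph_iso E1 E2).
Proof. by apply: (iffP existsP) => -[s]; [move/eqP; exists s | exists s; apply/eqP]. Qed.

Lemma relabel_comp (T U V : finType) (f : T -> U) (g : U -> V) (E : {set {set T}}) :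
  [set g @: e | e : {set U} in [set f @: e | e : {set T} in E]]
    = [set (g \o f) @: e | e : {set T} in E].
Proof. by rewrite -imset_comp; apply: eq_imset => e /=; rewrite -imset_comp. Qed.

Lemma graph_iso_refl k : reflexive (@graph_iso k).
Proof.
move=> E; apply/graph_isoP; exists 1%g.
rewrite (eq_imset (g := id)) ?imset_id // => e.
by rewrite (eq_imset (g := id)) ?imset_id // => x; rewrite perm1.
Qed.

Lemma graph_iso_sym k : symmetric (@graph_iso k).
Proof.
apply: symmetric_from_pre => E1 E2 /graph_isoP[s <-]; apply/graph_isoP.
exists (s^-1)%g; rewrite relabel_comp (eq_imset (g := id)) ?imset_id // => e.
by rewrite (eq_imset (g := id)) ?imset_id // => x; rewrite /= permK.
Qed.

Lemma graph_iso_trans k : transitive (@graph_iso k).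
Proof.
move=> E2 E1 E3 /graph_isoP[s <-] /graph_isoP[u <-]; apply/graph_isoP.
exists (s * u)%g; rewrite relabel_comp; apply: eq_imset => e.
by apply: eq_imset => x /=; rewrite permM.
Qed.

(** * Breadth-first search *)

Section Exploration.
Variables (T : finType) (D : {set {set T}}).

(** [L] lists the discovered vertices, entry [i] of [pi] is the position of the parent of vertex
    [i.+1], and the first [q] vertices are fully scanned. A round either discovers a neighbour of
    vertex [q], appending [q] to [pi], or increases [q]; so [pi] stays sorted and the search
    ends. *)
Lemma bfs_from (x : T) (L : seq T) (pi : seq nat) (q : nat) :
  uniq L -> size L = (size pi).+1 -> nth x L 0 = x -> q <= size L ->
  sorted leq pi -> all (leq^~ q) pi ->
  (forall i, i < size pi -> nth 0 pi i <= i /\ [set nth x L (nth 0 pi i); nth x L i.+1] \in D) ->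
  (forall y z, y \in take q L -> [set y; z] \in D -> z \in L) ->
  exists (L' : seq T) (pi' : seq nat),
    [/\ uniq L', size L' = (size pi').+1, nth x L' 0 = x, sorted leq pi'
      & (forall i, i < size pi' ->
           nth 0 pi' i <= i /\ [set nth x L' (nth 0 pi' i); nth x L' i.+1] \in D)
        /\ (forall y z, y \in L' -> [set y; z] \in D -> z \in L')].
Proof.
have [k] := ubnP ((#|T| + #|T|) - (size L + q)).
elim: k L pi q => // k IH L pi q hk uL sL x0 qL spi piq hpi clo.
have LT : size L <= #|T| by rewrite -(card_uniqP uL) max_card.
case: (ltngtP q (size L)) qL => // [qL _|qL _]; last first.
  by exists L, pi; split=> //; split=> // y z yL; apply: clo; rewrite qL take_size.
set y := nth x L q.
case: (pickP (fun z => ([set y; z] \in D) && (z \notin L))) => [z /andP[yzD zL]|noz].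
  have LT' : size (rcons L z) <= #|T|.
    have u' : uniq (rcons L z) by rewrite rcons_uniq zL.
    by rewrite -(card_uniqP u') max_card.
  apply: (IH (rcons L z) (rcons pi q) q).
  - by rewrite size_rcons in LT' *; lia.
  - by rewrite rcons_uniq zL.
  - by rewrite !size_rcons sL.
  - by rewrite nth_rcons sL.
  - by rewrite size_rcons; lia.
  - case: (pi) spi piq => //= a s; rewrite rcons_path => -> /andP[aq /allP sq] /=.
    by have := mem_last a s; rewrite inE => /predU1P[->|/sq].
  - by rewrite all_rcons leqnn.
  - move=> i; rewrite size_rcons ltnS leq_eqVlt => /predU1P[->|ilt].
      rewrite nth_rcons ltnn eqxx; split; first by rewrite -ltnS -sL.
      by rewrite !nth_rcons qL sL ltnn eqxx.
    have [h1 h2] := hpi i ilt.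
    rewrite nth_rcons ilt; split=> //; rewrite !nth_rcons sL !ltnS ilt.
    by rewrite (leq_trans h1 (ltnW ilt)).
  - move=> u v; rewrite -cats1 takel_cat ?(ltnW qL) // => uq uv.
    by rewrite mem_cat (clo _ _ uq uv).
apply: (IH L pi q.+1) => //.
- by lia.
- by apply: sub_all piq => a /= /leqW.
- move=> u v; rewrite (take_nth x qL) mem_rcons inE => /predU1P[->|/clo]; last exact.
  by move=> yv; have := noz v; rewrite yv /=; case: (v \in L).
Qed.

(* The parents occur in sorted order along the exploration, so a search tree is one of at most [4 ^ size pi] sorted sequences. *)
Lemma bfs (x : T) :
  exists (L : seq T) (pi : seq nat),
    [/\ uniq L, size L = (size pi).+1, nth x L 0 = x, sorted leq pi
      & (forall i, i < size pi ->
           nth 0 pi i <= i /\ [set nth x L (nth 0 pi i); nth x L i.+1] \in D)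
        /\ (forall y z, y \in L -> [set y; z] \in D -> z \in L)].
Proof. exact: (@bfs_from x [:: x] [::] 0). Qed.

End Exploration.

(* The root has index 0, and [t] lists the parents of the vertices 1, ..., m in this order. *)
Definition tree_edges m (t : m.-tuple 'I_m.+1) : {set 'I_m.+1 * 'I_m.+1} :=
  [set (tnth t i, lift ord0 i) | i : 'I_m].

Definition sorted_parents m : {set m.-tuple 'I_m.+1} :=
  [set t : m.-tuple 'I_m.+1 | sorted leq (map val t)].

(** Storing an edge as an increasing pair of indices ensures that distinct pairs are distinct
    edges. *)
Definition upper_pairs k : {set 'I_k * 'I_k} := [set p : 'I_k * 'I_k | p.1 < p.2].

Definition pattern_embeds k n (Q : {set 'I_k * 'I_k}) (G : {set {set 'I_n}}) : bool :=
  [exists f : {ffun 'I_k -> 'I_n},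
     injectiveb f && [forall p in Q, [set f p.1; f p.2] \in G]].

Definition tree_patterns m n (G : {set {set 'I_n}}) : {set {set 'I_m.+1 * 'I_m.+1}} :=
  [set Q : {set 'I_m.+1 * 'I_m.+1} | [&& Q \subset upper_pairs m.+1,
     pattern_embeds Q G & [exists t in sorted_parents m, tree_edges t \subset Q]]].

Definition edge_code k (Q : {set 'I_k * 'I_k}) : seq (nat * nat) :=
  [seq (val p.1, val p.2) | p <- enum Q].

Definition shift_code (m : nat) (es : seq (nat * nat)) :=
  [seq (m + p.1, m + p.2) | p <- es].

(** Components are peeled off one by one: the first takes the indices up to [m], and the code of the
    rest is shifted past it. Each component uses up a vertex, so fuel [k] suffices. *)
Fixpoint codes n (G : {set {set 'I_n}}) (fuel k : nat) : seq (seq (nat * nat)) :=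
  if fuel is f.+1 then
    if k is 0 then [:: [::]] else
    flatten [seq [seq edge_code Q ++ shift_code m.+1 es
                 | Q <- enum (tree_patterns m G), es <- codes G f (k - m.+1)]
            | m <- iota 0 k]
  else [:: [::]].

(** * Decomposition into components *)

Section Coding.
Variables (T : finType) (x0 : T).

Definition code_edge (L : seq T) (p : nat * nat) : {set T} :=
  [set nth x0 L p.1; nth x0 L p.2].

(** A code fixes the graph with vertex set [S] and edge set [D] up to the order [L] of its vertices.
    The bound on the indices keeps the default [x0] from ever being read. *)
Definition coded (es : seq (nat * nat)) (S : {set T}) (D : {set {set T}}) : Prop :=
  exists L : seq T, [/\ uniq L, L =i S,
    all (fun p => (p.1 < size L) && (p.2 < size L)) es
    & forall e, (e \in D) = (e \in [seq code_edge L p | p <- es])].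

Lemma coded_cat es1 es2 (A B : {set T}) (D1 D2 : {set {set T}}) :
  [disjoint A & B] -> coded es1 A D1 -> coded es2 B D2 ->
  coded (es1 ++ shift_code #|A| es2) (A :|: B) (D1 :|: D2).
Proof.
move=> dAB [L1 [u1 L1A es1L e1]] [L2 [u2 L2B es2L e2]].
have sA : #|A| = size L1 by rewrite -(card_uniqP u1); apply: eq_card => x; rewrite L1A.
exists (L1 ++ L2); split.
- rewrite cat_uniq u1 u2 andbT; apply/hasPn => x /=; rewrite L1A L2B => xB.
  by apply: contraL xB => /(disjointFr dAB) ->.
- by move=> x; rewrite mem_cat inE L1A L2B.
- rewrite all_cat size_cat; apply/andP; split.
    by apply: sub_all es1L => p /= /andP[? ?]; lia.
  by rewrite all_map; apply: sub_all es2L => p /= /andP[? ?]; lia.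
- move=> e; rewrite inE e1 e2 map_cat mem_cat -map_comp; congr (_ || _).
    congr (e \in _); apply/eq_in_map => p /(allP es1L) /andP[h1 h2].
    by rewrite /code_edge !nth_cat h1 h2.
  congr (e \in _); apply: eq_map => p; rewrite /code_edge /= !nth_cat sA.
  by rewrite !ltnNge !leq_addr /= !addKn.
Qed.

(** Match the vertices at equal positions of the two enumerations. *)
Lemma coded_iso es (S : {set T}) (D1 D2 : {set {set T}}) :
  coded es S D1 -> coded es S D2 ->
  exists2 f : T -> T, {in S &, injective f} & [set f @: e | e : {set T} in D1] = D2.
Proof.
move=> [L1 [u1 L1S es1L e1]] [L2 [u2 L2S es2L e2]].
have sL : size L1 = size L2.
  by rewrite -(card_uniqP u1) -(card_uniqP u2); apply: eq_card => x; rewrite L1S L2S.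
pose f x := nth x0 L2 (index x L1).
exists f.
  move=> x y; rewrite -!L1S => xL yL /eqP.
  rewrite /f nth_uniq -?sL ?index_mem // => /eqP /(congr1 (nth x0 L1)).
  by rewrite !nth_index.
have fe p : p \in es -> f @: code_edge L1 p = code_edge L2 p.
  move=> /(allP es1L) /andP[h1 h2].
  by rewrite /code_edge imsetU1 imset_set1 /f !index_uniq.
apply/setP => e; rewrite e2; apply/imsetP/mapP => [[e']|[p pe ->]].
  by rewrite e1 => /mapP[p pe ->] ->; exists p => //; apply: fe.
by exists (code_edge L1 p); rewrite ?fe // e1 map_f.
Qed.

(** Search from [x]: [A] is its component in [D], and [Q] records the edges inside [A] by search
    positions. As [A] is closed under adjacency, no edge leaves it. *)
Lemma tree_pattern_code n (G : {set {set 'I_n}}) (g : T -> 'I_n)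
    (D : {set {set T}}) (x : T) (S : {set T}) :
  injective g -> x \in S ->
  (forall e, e \in D -> [/\ #|e| = 2, e \subset S & g @: e \in G]) ->
  exists m (A : {set T}) (Q : {set 'I_m.+1 * 'I_m.+1}),
    [/\ #|A| = m.+1, A \subset S, Q \in tree_patterns m G,
        coded (edge_code Q) A [set e in D | e \subset A]
      & forall e, e \in D -> e \subset A \/ e \subset S :\: A].
Proof.
move=> ginj xS hD; have [L [pi [uL sL Lx spi [hpi clo]]]] := bfs D x.
pose m := size pi; pose A := [set y in L].
pose Q := [set p : 'I_m.+1 * 'I_m.+1 | (p.1 < p.2) && ([set nth x L p.1; nth x L p.2] \in D)].
have nthx i : nth x L i = nth x0 L i \/ size L <= i.
  by case: (ltnP i (size L)) => h; [left; apply: set_nth_default | right].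
have ordL (i : 'I_m.+1) : i < size L by rewrite sL.
have nthE (i : 'I_m.+1) : nth x L i = nth x0 L i by apply: set_nth_default.
exists m, A, Q; split.
- by rewrite cardsE (card_uniqP uL) sL.
- apply/subsetP => y; rewrite inE => /(nthP x)[[|i] ilt <-]; first by rewrite Lx.
  rewrite sL ltnS in ilt; have [_ /hD[_ /subsetP sub _]] := hpi i ilt.
  by apply: sub; rewrite !inE eqxx orbT.
- rewrite inE; apply/and3P; split.
  + by apply/subsetP => p; rewrite !inE => /andP[].
  + apply/existsP; exists [ffun i : 'I_m.+1 => g (nth x L i)]; apply/andP; split.
      apply/injectiveP => i j; rewrite !ffunE => /ginj /eqP.
      by rewrite nth_uniq // => /eqP /val_inj.
    apply/forall_inP => p; rewrite inE => /andP[_ /hD[_ _]].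
    by rewrite imsetU1 imset_set1 !ffunE.
  + pose t := [tuple (inord (nth 0 pi i) : 'I_m.+1) | i < m].
    have ti (i : 'I_m) : tnth t i = nth 0 pi i :> nat.
      by rewrite tnth_mktuple inordK // ltnS (leq_trans (hpi i _).1) // ltnW.
    apply/existsP; exists t; apply/andP; split.
      rewrite inE; suff -> : map val t = pi by [].
      apply: (@eq_from_nth _ 0); rewrite size_map size_tuple // => i im.
      rewrite (nth_map ord0) ?size_tuple // -[i]/(val (Ordinal im)) -tnth_nth.
      exact: ti.
    apply/subsetP => _ /imsetP[i _ ->]; rewrite inE /= ti.
    have [h1 h2] := hpi i (ltn_ord i).
    by rewrite /bump /= add1n ltnS h1.
- exists L; split=> //.
  + by move=> y; rewrite inE.
  + by apply/allP => _ /mapP[p _ ->] /=; rewrite !ordL.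
  + move=> e; rewrite inE -map_comp; apply/andP/mapP.
      move=> [eD /subsetP eA]; have [/eqP/cards2P[u [v [uv euv]]] _ _] := hD e eD.
      have uL' : u \in L by have := eA u; rewrite euv !inE eqxx; apply.
      have vL' : v \in L by have := eA v; rewrite euv !inE eqxx orbT; apply.
      (* Ordering the two ends by search position makes the edge an upper pair. *)
      wlog lt_uv : u v uv euv uL' vL' / index u L < index v L.
        move=> W; case: (ltngtP (index u L) (index v L)) => h; first exact: (W u v).
          by apply: (W v u); rewrite // 1?eq_sym // setUC.
        by case/eqP: uv; rewrite -(nth_index x uL') h nth_index.
      have iu : index u L < m.+1 by rewrite -sL index_mem.
      have iv : index v L < m.+1 by rewrite -sL index_mem.
      exists (Ordinal iu, Ordinal iv).
        by rewrite mem_enum inE /= !nth_index // lt_uv -euv.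
      by rewrite /code_edge /= !nth_index.
    move=> [p]; rewrite mem_enum inE => /andP[_ pD] ->.
    rewrite /code_edge /= -!nthE; split=> //.
    by apply/subsetP => y; rewrite !inE => /orP[] /eqP ->; rewrite mem_nth.
- move=> e eD; have [/eqP/cards2P[u [v [uv euv]]] eS _] := hD e eD.
  have sym : [set v; u] \in D by rewrite setUC -euv.
  case: (boolP (u \in L)) => uL'.
    left; apply/subsetP => y; rewrite euv !inE => /orP[] /eqP -> //.
    by apply: (clo u); rewrite // -euv.
  right; rewrite subsetD eS disjoint_sym disjoints_subset; apply/subsetP => y.
  rewrite !inE euv !inE => yL; apply/norP; split; apply: contraNneq uL' => yE.
    by rewrite -yE.
  by apply: clo sym; rewrite -yE.
Qed.

Lemma codesP n (G : {set {set 'I_n}}) (g : T -> 'I_n) f (D : {set {set T}}) (S : {set T}) :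
  injective g -> #|S| <= f ->
  (forall e, e \in D -> [/\ #|e| = 2, e \subset S & g @: e \in G]) ->
  exists2 es, es \in codes G f #|S| & coded es S D.
Proof.
move=> ginj; elim: f S D => [|f IH] S D.
  rewrite leqn0 cards_eq0 => /eqP-> hD.
  exists [::]; first by rewrite inE.
  exists [::]; split=> // [x|e]; first by rewrite !inE.
  rewrite in_nil; apply: negbTE; apply/negP => /hD[e2]; rewrite subset0 => /eqP e0.
  by rewrite e0 cards0 in e2.
move=> Sf hD; case: (set_0Vmem S) => [S0|[x xS]].
  rewrite S0 cards0 /=; exists [::]; first by rewrite inE.
  exists [::]; split=> // [y|e]; first by rewrite !inE.
  rewrite in_nil; apply: negbTE; apply/negP => /hD[e2]; rewrite S0 subset0 => /eqP e0.
  by rewrite e0 cards0 in e2.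
have [m [A [Q [cA AS QG cod split_]]]] := tree_pattern_code ginj xS hD.
have cSA : #|S :\: A| = #|S| - m.+1 by rewrite cardsDS // cA.
have mS : m < #|S| by rewrite -cA subset_leq_card.
have [|e|es esin escod] := IH (S :\: A) [set e in D | e \subset S :\: A].
- by rewrite cSA; lia.
- by rewrite inE => /andP[/hD[e2 _ eG] eSA].
exists (edge_code Q ++ shift_code m.+1 es).
  rewrite /=; case: (#|S|) mS cSA => // k mS cSA.
  apply/flatten_mapP; exists m; first by rewrite mem_iota.
  apply: allpairs_f; rewrite ?mem_enum //; by rewrite -cSA.
have -> : S = A :|: (S :\: A) by rewrite setDE setUIr setUCr setIT; apply/esym/setUidPr.
have -> : D = [set e in D | e \subset A] :|: [set e in D | e \subset S :\: A].
  apply/setP => e; rewrite !inE -andb_orr.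
  by case eD : (e \in D) => //=; case: (split_ e eD) => ->; rewrite ?orbT.
rewrite -[X in shift_code X]cA; apply: coded_cat => //.
by rewrite -setI_eq0 setDE setIC -setIA [~: A :&: A]setIC setICr setI0.
Qed.

End Coding.

(** Every subgraph has a code and graphs with equal codes are isomorphic, so picking one graph per
    code, as [phi] does, reaches every class. *)
Lemma s_k_codes k n (G : {set {set 'I_n}}) : is_graph G -> 0 < k ->
  s_k k G <= size (codes G k k).
Proof.
case: k => // k gG _.
pose R es H := `[< @coded 'I_k.+1 ord0 es setT H >].
pose cl (H : {set {set 'I_k.+1}}) := [set H' in sub_graphs k.+1 G | graph_iso H H'].
pose phi es := if [pick H | R es H] is Some H then cl H else set0.
rewrite /s_k -(size_map phi); apply: leq_trans (card_size _).
apply: subset_leq_card; apply/subsetP => _ /imsetP[H Hsub ->].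
move: (Hsub); rewrite inE => /andP[gH /existsP[g /andP[/injectiveP ginj /forall_inP gE]]].
have [|e eH|es] := @codesP 'I_k.+1 ord0 n G g k.+1 H setT ginj.
- by rewrite cardsT card_ord.
- by split; [have := subsetP gH e eH; rewrite inE => /eqP | rewrite subsetT | apply: gE].
rewrite cardsT card_ord => esin escod; apply/mapP; exists es => //.
rewrite /phi; case: pickP => [H1 /asboolP cod1|/(_ H)]; last first.
  by move/asboolPn/(_ escod).
have [f finj fE] := coded_iso escod cod1.
have HH1 : graph_iso H H1.
  have fi : injective f by move=> x y; apply: finj; rewrite inE.
  apply/graph_isoP; exists (perm fi); rewrite -fE; apply: eq_imset => e.
  by apply: eq_imset => x; rewrite permE.
apply/setP => H'; rewrite !inE; congr (_ && _).
by apply/idP/idP; apply: graph_iso_trans; rewrite // graph_iso_sym.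
Qed.

(** * Counting tree patterns *)

Lemma leq_card_bigcup (I T : finType) (P : pred I) (F : I -> {set T}) :
  #|\bigcup_(i | P i) F i| <= \sum_(i | P i) #|F i|.
Proof.
elim/big_rec2: _ => [|i m A _ IH]; first by rewrite cards0.
by rewrite cardsU (leq_trans (leq_subr _ _)) // leq_add2l.
Qed.

(** The tree has [m] edges, so [m.+1 < #|Q|] asks for at least two extra ones. *)
Definition excess_patterns m n (G : {set {set 'I_n}}) (t : m.-tuple 'I_m.+1) :
    {set {set 'I_m.+1 * 'I_m.+1}} :=
  [set Q : {set 'I_m.+1 * 'I_m.+1} | [&& Q \subset upper_pairs m.+1,
     tree_edges t \subset Q, m.+1 < #|Q| & pattern_embeds Q G]].

Definition excess_count m n (G : {set {set 'I_n}}) : nat :=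
  \sum_(t in sorted_parents m) #|excess_patterns G t|.

Lemma card_tree_edges m (t : m.-tuple 'I_m.+1) : #|tree_edges t| = m.
Proof. by rewrite card_imset ?card_ord // => i j /(congr1 snd) /lift_inj. Qed.

(** Sorted sequences are multisets, ['C(m + m, m)] in number, and this is one term in the expansion
    of [(1 + 1) ^ (m + m)]. *)
Lemma card_sorted_parents m : #|sorted_parents m| <= 4 ^ m.
Proof.
rewrite card_sorted_tuples (_ : 4 ^ m = (1 + 1) ^ (m + m)); last by rewrite expnD -expnMn.
rewrite expnDn.
rewrite (bigD1 (inord m : 'I_(m + m).+1)) //= inordK ?ltnS ?leq_addr //.
by rewrite !exp1n !muln1 leq_addr.
Qed.

Lemma card_tree_patterns m n (G : {set {set 'I_n}}) :
  #|tree_patterns m G| <= 16 ^ m.+1 + excess_count m G.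
Proof.
(* The tree with at most one added pair; [None] adds nothing. *)
pose few t : {set {set 'I_m.+1 * 'I_m.+1}} :=
  [set (if o is Some p then p |: tree_edges t else tree_edges t)
   | o : option ('I_m.+1 * 'I_m.+1)].
have fewC t : #|few t| <= (m.+1 * m.+1).+1.
  by apply: leq_trans (leq_imset_card _ _) _; rewrite card_option card_prod card_ord.
have sub : tree_patterns m G \subset \bigcup_(t in sorted_parents m) (few t :|: excess_patterns G t).
  apply/subsetP => Q; rewrite inE => /and3P[up emb /existsP[t /andP[ts tQ]]].
  apply/bigcupP; exists t => //; rewrite !inE up tQ emb andbT /=.
  case: ltnP => Qm; rewrite ?orbT // orbF.
  have := cardsDS tQ; rewrite card_tree_edges => cD.
  have QE : Q = (Q :\: tree_edges t) :|: tree_edges t.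
    apply/setP => p; rewrite !inE.
    by case: (boolP (p \in tree_edges t)) => [/(subsetP tQ) ->|_]; rewrite ?orbT ?orbF.
  case: (posnP #|Q :\: tree_edges t|) => [/cards0_eq D0|Dpos].
    by apply/imsetP; exists None; rewrite // QE D0 set0U.
  have /cards1P[p Dp] : #|Q :\: tree_edges t| == 1 by rewrite eqn_leq Dpos andbT cD leq_subLR addn1.
  by apply/imsetP; exists (Some p); rewrite // {1}QE Dp.
apply: leq_trans (subset_leq_card sub) _.
apply: leq_trans (leq_card_bigcup _ _) _.
apply: (@leq_trans (\sum_(t in sorted_parents m) ((m.+1 * m.+1).+1 + #|excess_patterns G t|))).
  apply: leq_sum => t _; apply: leq_trans (leq_add (fewC t) (leqnn _)).
  by rewrite cardsU leq_subr.
rewrite big_split /= leq_add2r sum_nat_const.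
(* The budget [16 ^ m.+1] splits into [4 ^ m] trees and [4 ^ m.+1 * 4] choices of the optional
   pair. *)
apply: leq_trans (leq_mul (card_sorted_parents m) (_ : _ <= 4 ^ m.+1 * 4)) _.
  by elim: (m) => // i IH; rewrite expnS; nia.
by rewrite mulnA mulnAC -expnSr -expnMn.
Qed.

Lemma size_codesS n (G : {set {set 'I_n}}) f k :
  size (codes G f.+1 k.+1) =
    \sum_(0 <= m < k.+1) #|tree_patterns m G| * size (codes G f (k.+1 - m.+1)).
Proof.
rewrite -[codes G f.+1 k.+1]/(flatten [seq _ | m <- iota 0 k.+1]).
rewrite size_flatten /shape -map_comp sumnE big_map /index_iota subn0.
by apply: eq_bigr => m _; rewrite /= size_allpairs -cardE.
Qed.

(** * Expected excess and the exponential upper bound *)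

Section UpperBound.
Variable R : realType.
Local Open Scope ring_scope.

(** The factor 2 pays for the choice of component sizes: a first component of size [m.+1]
    contributes at most [B ^+ k * 2 ^+ (k - m.+1)], and these powers of two sum to at most
    [2 ^+ k]. *)
Lemma size_codes n (G : {set {set 'I_n}}) (B : R) f k : 0 <= B -> (k <= f)%N ->
  (forall m, (m < k)%N -> #|tree_patterns m G|%:R <= B ^+ m.+1) ->
  (size (codes G f k))%:R <= (2 * B) ^+ k.
Proof.
move=> B0; elim: f k => [|f IH] [|k] // kf hB.
rewrite size_codesS natr_sum.
have geo j : \sum_(0 <= m < j) B ^+ j * 2 ^+ (j - m.+1) <= (2 * B) ^+ j.
  rewrite -mulr_sumr exprMn mulrC ler_wpM2r ?exprn_ge0 //.
  elim: j => [|j IHj]; first by rewrite big_nil ler01.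
  rewrite big_nat_recl //= subSS subn0 exprS mulr_natl mulr2n lerD2l.
  by under eq_bigr do rewrite subSS.
apply: le_trans (geo k.+1).
rewrite big_nat [leRHS]big_nat; apply: ler_sum => m /= mk.
rewrite natrM.
apply: le_trans (ler_pM _ _ (hB m mk) (IH (k.+1 - m.+1)%N _ _)) _ => //.
- by lia.
- by move=> i ik; apply: hB; lia.
by rewrite exprMn mulrCA -exprD subnKC // mulrC.
Qed.

(** Union bound over placements. An injective placement needs [#|Q|] distinct edges, because
    increasing pairs never name the same edge twice. *)
Lemma pattern_embeds_prob k n (p : R) (Q : {set 'I_k * 'I_k}) :
  0 <= p <= 1 -> Q \subset upper_pairs k ->
  gnp_prob p (@pattern_embeds k n Q) <= n%:R ^+ k * p ^+ #|Q|.
Proof.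
move=> p01 up; have p0 : 0 <= p by case/andP: p01.
pose F (f : {ffun 'I_k -> 'I_n}) := [set [set f q.1; f q.2] | q in Q].
rewrite gnp_mean_prob.
apply: le_trans (gnp_mean_le p01
  (Y := fun E => \sum_(f : {ffun 'I_k -> 'I_n} | injectiveb f) (F f \subset E)%:R) _) _.
  move=> E _; case: (boolP (pattern_embeds Q E)) => [/existsP[f /andP[fi fE]]|_].
    rewrite (bigD1 f) //= (_ : F f \subset E) ?lerDl ?sumr_ge0 //.
    by apply/subsetP => _ /imsetP[q qQ ->]; move/forall_inP: fE; apply.
  by rewrite sumr_ge0.
rewrite gnp_mean_sum.
have -> : n%:R ^+ k * p ^+ #|Q| = \sum_(f : {ffun 'I_k -> 'I_n}) p ^+ #|Q|.
  by rewrite sumr_const card_ffun !card_ord -natrX mulr_natl.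
rewrite [leRHS](bigID (fun f : {ffun 'I_k -> 'I_n} => injectiveb f)) /=.
apply: ler_wpDr; first by apply: sumr_ge0 => *; rewrite exprn_ge0.
apply: ler_sum => f /injectiveP fi.
rewrite -(gnp_mean_prob p (fun E => F f \subset E)) gnp_prob_superset.
  rewrite card_in_imset // => -[a b] [c d] /(subsetP up) + /(subsetP up).
  rewrite !inE /= => ab cd /setP eqs.
  have := eqs (f a); have := eqs (f b); rewrite !inE !eqxx ?orbT !(inj_eq fi).
  move=> /esym/orP[] /eqP ? /esym/orP[] /eqP ?; subst=> //; move: ab cd => /=; lia.
apply/subsetP => _ /imsetP[q /(subsetP up) + ->]; rewrite !inE => q12.
by rewrite cards2 (inj_eq fi) neq_ltn q12.
Qed.

(* With l = j/n and q = d/j, at least two extra edges give the gain l^2, while the sum of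
   q^r over all edge sets stays below (1 + d/j)^(j^2) <= exp(d)^j. *)
Lemma excess_weight m (t : m.-tuple 'I_m.+1) (l q : R) : 0 <= l <= 1 -> 0 <= q ->
  \sum_(Q : {set 'I_m.+1 * 'I_m.+1} | (tree_edges t \subset Q) && (m.+1 < #|Q|)%N)
     (l * q) ^+ #|Q| <= (l * q) ^+ m * l ^+ 2 * (1 + q) ^+ (m.+1 * m.+1).
Proof.
move=> /andP[l0 l1] q0.
apply: (@le_trans _ _ (\sum_(Q : {set 'I_m.+1 * 'I_m.+1} | (tree_edges t \subset Q) && (Q \subset setT))
     (l * q) ^+ m * l ^+ 2 * (q ^+ #|Q :\: tree_edges t| * 1 ^+ #|setT :\: Q|))).
  rewrite [leRHS](bigID (fun Q : {set 'I_m.+1 * 'I_m.+1} => (m.+1 < #|Q|)%N)) /=.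
  apply: ler_wpDr.
    by apply: sumr_ge0 => Q _; rewrite !mulr_ge0 ?exprn_ge0 ?mulr_ge0.
  rewrite [leRHS](eq_bigl (fun Q : {set 'I_m.+1 * 'I_m.+1} =>
      (tree_edges t \subset Q) && (m.+1 < #|Q|)%N)); last by move=> Q; rewrite subsetT andbT.
  apply: ler_sum => Q /andP[tQ mQ]; rewrite expr1n mulr1.
  have cD := cardsDS tQ; rewrite card_tree_edges in cD.
  have -> : #|Q| = (m + #|Q :\: tree_edges t|)%N by rewrite cD subnKC // ltnW // ltnW.
  have r2 : (2 <= #|Q :\: tree_edges t|)%N by rewrite cD leq_subRL ?addn2 // ltnW // ltnW.
  rewrite exprD -mulrA ler_wpM2l ?exprn_ge0 ?mulr_ge0 // exprMn ler_wpM2r ?exprn_ge0 //.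
  by rewrite -(subnKC r2) exprD ler_piMr ?exprn_ge0 ?exprn_ile1.
rewrite -mulr_sumr sum_interval ?subsetT // [q + 1]addrC ler_wpM2l ?mulr_ge0 ?exprn_ge0 ?mulr_ge0 //.
rewrite ler_weXn2l ?lerDl //; apply: leq_trans (subset_leq_card (subsetDl _ _)) _.
by rewrite cardsT card_prod card_ord.
Qed.

Lemma excess_mean m n (d : R) : 0 <= d -> d <= n%:R -> (m < n)%N ->
  gnp_mean (d / n%:R) (fun E : {set {set 'I_n}} => (excess_count m E)%:R)
    <= (16 * (1 + d) * expR d) ^+ m.+1 / n%:R.
Proof.
move=> d0 dn mn; have n0 : 0 < n%:R :> R by rewrite ltr0n (leq_trans _ mn).
have p01 : 0 <= d / n%:R <= 1 by rewrite divr_ge0 ?(ltW n0) //= ler_pdivrMr // mul1r.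
set k : R := m.+1%:R; have k0 : 0 < k by rewrite ltr0n.
set p := d / n%:R in p01 *; pose l := k / n%:R; pose q := d / k.
have plq : p = l * q by rewrite /p /l /q [RHS]mulrC mulrA divfK ?gt_eqF.
have l01 : 0 <= l <= 1.
  by rewrite divr_ge0 ?(ltW n0) ?(ltW k0) //= ler_pdivrMr // mul1r ler_nat.
have q0 : 0 <= q by rewrite divr_ge0 // ltW.
have treeE (t : m.-tuple 'I_m.+1) :
    gnp_mean p (fun E : {set {set 'I_n}} => #|excess_patterns E t|%:R)
      <= n%:R ^+ m.+1 * (p ^+ m * l ^+ 2 * (1 + q) ^+ (m.+1 * m.+1)).
  apply: le_trans (gnp_mean_le p01 (Y := fun E =>
    \sum_(Q : {set 'I_m.+1 * 'I_m.+1} | [&& Q \subset upper_pairs m.+1,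
       tree_edges t \subset Q & (m.+1 < #|Q|)%N]) (pattern_embeds Q E)%:R) _) _.
    move=> E _; rewrite -sum1_card natr_sum.
    rewrite [leRHS](eq_bigr (fun Q => if pattern_embeds Q E then 1 else 0)); last first.
      by move=> Q _; case: ifP.
    rewrite -big_mkcondr /=.
    rewrite le_eqVlt; apply/orP; left; apply/eqP.
    by apply: eq_bigl => Q; rewrite !inE -!andbA.
  rewrite gnp_mean_sum plq; apply: le_trans (ler_wpM2l _ (excess_weight t l01 q0)); last first.
    by rewrite exprn_ge0 ?(ltW n0).
  rewrite mulr_sumr -plq.
  rewrite [leRHS](bigID (fun Q : {set 'I_m.+1 * 'I_m.+1} => Q \subset upper_pairs m.+1)) /=.
  apply: ler_wpDr.
    apply: sumr_ge0 => Q _; rewrite mulr_ge0 ?exprn_ge0 ?(ltW n0) //.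
    by case/andP: p01.
  rewrite [leLHS](eq_bigl (fun Q : {set 'I_m.+1 * 'I_m.+1} =>
    (tree_edges t \subset Q) && (m.+1 < #|Q|)%N && (Q \subset upper_pairs m.+1))); last first.
    by move=> Q; rewrite [RHS]andbC.
  apply: ler_sum => Q /andP[_ up].
  by rewrite -gnp_mean_prob; exact: pattern_embeds_prob.
have -> : gnp_mean p (fun E : {set {set 'I_n}} => (excess_count m E)%:R) =
    \sum_(t in sorted_parents m) gnp_mean p (fun E : {set {set 'I_n}} => #|excess_patterns E t|%:R).
  by rewrite -gnp_mean_sum; apply: eq_bigr => E _; rewrite natr_sum.
apply: (@le_trans _ _ (\sum_(t in sorted_parents m)
    n%:R ^+ m.+1 * (p ^+ m * l ^+ 2 * (1 + q) ^+ (m.+1 * m.+1)))).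
  by apply: ler_sum => t _; apply: treeE.
rewrite sumr_const -[leLHS]mulr_natl.
(* The placements outweigh [p ^+ m] by one factor [n], and [l ^+ 2] brings [n ^- 2]; what remains is
   the decisive [1 / n]. *)
have npE : n%:R ^+ m.+1 * (p ^+ m * l ^+ 2 * (1 + q) ^+ (m.+1 * m.+1))
    = d ^+ m * k ^+ 2 * (1 + q) ^+ (m.+1 * m.+1) / n%:R.
  rewrite exprS /p /l !expr_div_n; field.
  by rewrite gt_eqF //= expf_neq0 ?gt_eqF.
rewrite npE mulrA ler_wpM2r ?invr_ge0 ?(ltW n0) //.
rewrite exprMn exprMn.
(* One [4 ^+ m.+1] pays for the trees, the other for [k ^+ 2]. The last factor comes from
   [1 + q <= expR q] and [k * q = d]. *)
have -> : 16 = 4 * 4 :> R by rewrite -natrM.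
rewrite exprMn; set k2 := k ^+ 2.
have k20 : 0 <= k2 by rewrite exprn_ge0 // ltW.
rewrite (mulrC (d ^+ m)) !mulrA.
apply: ler_pM; rewrite ?mulr_ge0 ?exprn_ge0 ?addr_ge0 //; last first.
  rewrite exprM lerXn2r ?nnegrE ?exprn_ge0 ?addr_ge0 ?expR_ge0 //.
  have -> : expR d = expR q ^+ m.+1.
    by rewrite -expRM_natl /q mulrCA divff ?mulr1 // gt_eqF.
  by rewrite lerXn2r ?nnegrE ?addr_ge0 ?expR_ge0 // expR_ge1Dx.
apply: ler_pM; rewrite ?mulr_ge0 ?exprn_ge0 //; last first.
  apply: (@le_trans _ _ ((1 + d) ^+ m)).
    by rewrite lerXn2r ?nnegrE ?addr_ge0 // lerDr.
  by rewrite ler_weXn2l ?lerDl.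
have S4 : #|sorted_parents m|%:R <= 4 ^+ m.+1 :> R.
  by rewrite -natrX ler_nat (leq_trans (card_sorted_parents m)) // leq_exp2l.
have K4 : k2 <= 4 ^+ m.+1.
  rewrite /k2 /k -!natrX ler_nat.
  by elim: (m) => // i IH; rewrite [(4 ^ i.+2)%N]expnS; nia.
by rewrite -[_ * k * k]mulrA -expr2 ler_pM.
Qed.

Lemma whp_tiny (d : R) : 0 <= d -> exists c : R, 0 < c /\
  whp d (fun n G => monotone_tiny c G).
Proof.
move=> d0; pose C : R := 16 * (1 + d) * expR d.
have C0 : 0 < C.
  have d1 : 0 < 1 + d by lra.
  by rewrite !mulr_gt0 ?expR_gt0.
(* [16] covers patterns with at most one extra edge, [2 * C] those with more. *)
pose B := 16 + 2 * C; have B0 : 0 < B by rewrite /B; lra.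
have C20 : 0 < 2 * C by lra.
exists (2 * B); split; first by rewrite mulr_gt0.
(* With these weights [Y <= 1] bounds every excess count by [(2 * C) ^+ m.+1], so one use of Markov
   serves all sizes; the mean is at most the sum of [2 ^- m.+1 / n]. *)
pose Y n (E : {set {set 'I_n}}) : R :=
  \sum_(m < n) (2 * C) ^- m.+1 * (excess_count m E)%:R.
have w0 m : 0 < (2 * C) ^- m.+1 by rewrite invr_gt0 exprn_gt0.
apply: (@whp_of_mean R d _ Y 1 (fun n => n%:R^-1)) => //.
- move=> n E _ gE; apply: contraR; rewrite -ltNge => Y1.
  apply/allP => k; rewrite mem_iota add1n ltnS => /andP[k1 kn].
  apply: le_trans (_ : (size (codes E k k))%:R <= _); first by rewrite ler_nat s_k_codes.
  apply: size_codes; rewrite ?(ltW B0) // => m mk.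
  apply: le_trans (_ : (16 ^ m.+1 + excess_count m E)%:R <= _).
    by rewrite ler_nat card_tree_patterns.
  have ex : (excess_count m E)%:R <= (2 * C) ^+ m.+1.
    have mn : (m < n)%N by apply: leq_trans kn.
    rewrite -[leRHS]mulr1 mulrC -ler_pdivrMr ?exprn_gt0 // mulrC.
    apply: le_trans (ltW Y1); rewrite /Y (bigD1 (Ordinal mn)) //= lerDl.
    by apply: sumr_ge0 => i _; rewrite mulr_ge0 // ltW.
  rewrite natrD natrX; apply: le_trans (lerD (lexx _) ex) _; rewrite /B.
  have := ltW C20.
  move: (2 * C) => x x0; elim: m {mk ex} => [|m IH]; first by rewrite !expr1.
  rewrite exprS [x ^+ _]exprS [leRHS]exprS.
  have : 0 <= x ^+ m.+1 by rewrite exprn_ge0.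
  have : 0 <= 16 ^+ m.+1 :> R by rewrite exprn_ge0.
  nra.
- by move=> n E; apply: sumr_ge0 => m _; rewrite mulr_ge0 // ltW.
- move=> n n1 dn; rewrite /Y gnp_mean_sum.
  have n0 : 0 < n%:R :> R by rewrite ltr0n.
  apply: (@le_trans _ _ (\sum_(m < n) 2 ^- m.+1 * n%:R^-1)).
    apply: ler_sum => m _; rewrite gnp_meanZ.
    apply: le_trans (ler_wpM2l (ltW (w0 m)) (excess_mean d0 dn (ltn_ord m))) _.
    rewrite -/C mulrA ler_wpM2r ?invr_ge0 ?(ltW n0) // [(2 * C) ^+ _]exprMn invfM -mulrA mulVf ?mulr1 //.
    by rewrite expf_neq0 ?gt_eqF.
  rewrite -mulr_suml ler_piMl ?invr_ge0 ?(ltW n0) //.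
  suff -> : \sum_(m < n) 2 ^- m.+1 = 1 - 2 ^- n :> R.
    by rewrite gerBl invr_ge0 exprn_ge0.
  elim: (n) => [|j IH]; first by rewrite big_ord0 expr0 invr1 subrr.
  have h : 2 ^- j = 2 * 2 ^- j.+1 :> R by rewrite exprS invfM mulVKf ?pnatr_eq0.
  by rewrite big_ord_recr /= IH h; lra.
- move=> eps eps0; exists (Num.bound eps^-1).+1 => n nN.
  have n0 : 0 < n%:R :> R by rewrite ltr0n; apply: leq_trans nN.
  rewrite invf_plt ?posrE //; apply: lt_trans (archi_boundP _) _.
    by rewrite invr_ge0 ltW.
  by rewrite ltr_nat.
Qed.

End UpperBound.

(** * Long paths and many isomorphism classes *)

Lemma exists_subset_card (T : finType) (A : {set T}) t : t <= #|A| ->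
  exists2 B : {set T}, B \subset A & #|B| = t.
Proof.
move=> tA; exists [set x in take t (enum A)].
  by apply/subsetP => x; rewrite inE => /mem_take; rewrite mem_enum.
rewrite cardsE (card_uniqP (take_uniq _ (enum_uniq _))) size_takel //.
by rewrite -cardE.
Qed.

Definition joined k t (G : {set {set 'I_k}}) : bool :=
  [forall A : {set 'I_k}, forall B : {set 'I_k},
    [&& [disjoint A & B], t <= #|A| & t <= #|B|] ==>
      [exists a in A, exists b in B, [set a; b] \in G]].

Lemma joinedP k t (G : {set {set 'I_k}}) (A B : {set 'I_k}) : joined t G ->
  [disjoint A & B] -> t <= #|A| -> t <= #|B| ->
  exists a b, [/\ a \in A, b \in B & [set a; b] \in G].
Proof.
move=> /forallP/(_ A)/forallP/(_ B)/implyP jG dAB tA tB.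
have /exists_inP[a aA /exists_inP[b bB abG]] := jG (introT and3P (And3 dAB tA tB)).
by exists a, b.
Qed.

(* [U] holds the finished vertices, [p] the current path with its tip first, and the remaining vertices are unvisited. *)
Lemma dfs_state k (G : {set {set 'I_k}}) j : j <= k ->
  exists (U : {set 'I_k}) (p : seq 'I_k),
    [/\ uniq p, sorted (fun x y => [set x; y] \in G) p, (forall x, x \in U -> x \notin p),
        (forall u w, u \in U -> w \notin U -> w \notin p -> [set u; w] \notin G)
      & 2 * #|U| + size p = j].
Proof.
(* [j] counts moves: a vertex on the path has been pushed, a finished one pushed and popped. While
   [j < k], some vertex is unvisited. *)
elim: j => [|j IH] jk.
  exists set0, [::]; split=> //; last by rewrite cards0.
  by move=> u w; rewrite inE.
have [U [p [up sp Up noe szE]]] := IH (ltnW jk).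
have cP : #|[set x in p]| = size p by rewrite cardsE (card_uniqP up).
have [w wU wp] : exists2 w, w \notin U & w \notin p.
  have : #|U :|: [set x in p]| < k.
    by apply: leq_ltn_trans (leq_card_setU _ _) _; rewrite cP; lia.
  rewrite -[X in _ < X]card_ord -cardsT => /ltn_eqF/eqP neq.
  case: (pickP (fun w => w \notin U :|: [set x in p])) => [w|all_in].
    by rewrite !inE negb_or => /andP[? ?]; exists w.
  case: neq; congr #|pred_of_set _|; apply/setP => w; rewrite [RHS]inE.
  by have := all_in w; case: (w \in _).
case: p => [|x p] in up sp Up noe szE cP wp *.
  exists U, [:: w]; split=> //; last by move: szE => /=; lia.
    by move=> y yU; rewrite inE; apply: contraNneq wU => <-.
  by move=> u v uU vU _; apply: noe.
case: (pickP (fun v => [&& v \notin U, v \notin x :: p & [set v; x] \in G])) => [v|nov].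
  move=> /and3P[vU vp vx]; exists U, [:: v, x & p]; split=> //.
  - by rewrite cons_uniq vp.
  - by rewrite /= vx.
  - by move=> y yU; rewrite inE negb_or Up // andbT; apply: contraNneq vU => <-.
  - by move=> u y uU yU; rewrite inE negb_or => /andP[_]; apply: noe.
  - by move: szE => /=; lia.
move: up => /= /andP[xp up].
have xU : x \notin U by apply: contraL (mem_head x p) => /Up.
exists (x |: U), p; split=> //.
- exact: path_sorted sp.
- by move=> y; rewrite !inE => /predU1P[-> //|/Up]; rewrite inE negb_or => /andP[].
- move=> u y; rewrite !inE negb_or => /predU1P[->|uU] /andP[yx yU] yp.
    by have := nov y; rewrite yU inE (negbTE yx) yp /= setUC => ->.
  by apply: noe; rewrite // inE (negbTE yx).
- by rewrite cardsU1 xU; move: szE => /=; lia.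
Qed.

(** Stop the search after [k] moves. Then at least [#|U|] vertices are unvisited and none is
    adjacent to [U], so [#|U| < t], while the path has [k - 2 * #|U|] vertices. *)
Lemma joined_path k t (G : {set {set 'I_k}}) : joined t G ->
  exists p : seq 'I_k,
    [/\ uniq p, sorted (fun x y => [set x; y] \in G) p & k <= size p + 2 * t].
Proof.
move=> jG; have [U [p [up sp Up noe szE]]] := dfs_state G (leqnn k).
exists p; split=> //.
pose W := ~: (U :|: [set x in p]).
have cP : #|[set x in p]| = size p by rewrite cardsE (card_uniqP up).
have cW : k <= #|U| + size p + #|W|.
  rewrite -[X in X <= _]card_ord -(cardsC (U :|: [set x in p])) -cP leq_add2r.
  exact: leq_card_setU.
case: (ltnP #|U| t) => Ut; first by lia.
have dUW : [disjoint U & W].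
  by rewrite disjoints_subset setCK subsetUl.
have [|a [b [aU]]] := joinedP jG dUW Ut; first by lia.
by rewrite !inE negb_or => /andP[bU bp] abG; rewrite (negbTE (noe _ _ aU bU bp)) in abG.
Qed.

Definition nbr k (G : {set {set 'I_k}}) (x : 'I_k) : {set 'I_k} := [set y | [set x; y] \in G].

Lemma sum_degrees k (G : {set {set 'I_k}}) : is_graph G ->
  \sum_x #|nbr G x| <= 2 * #|G|.
Proof.
move=> gG; apply: (@leq_trans (\sum_x \sum_(e in G) (x \in e))).
  apply: leq_sum => x _.
  rewrite -(card_in_imset (f := fun y => [set x; y])).
    rewrite -sum1_card [leqRHS](bigID (fun e : {set 'I_k} => e \in [set [set x; y] | y in nbr G x])) /=.
    apply: leq_trans (leq_addr _ _).
    rewrite [leqRHS](eq_bigl (fun e : {set 'I_k} => e \in [set [set x; y] | y in nbr G x])).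
      by apply: leq_sum => _ /imsetP[y _ ->]; rewrite !inE eqxx.
    move=> e; rewrite andb_idl // => /imsetP[y]; rewrite inE => yG -> //.
  move=> y z; rewrite !inE => /(subsetP gG); rewrite inE cards2 => yx.
  move=> /(subsetP gG); rewrite inE cards2 => zx /setP/(_ y).
  rewrite !inE eqxx orbT => /esym/orP[/eqP yE|/eqP //].
  by rewrite yE eqxx in yx.
rewrite exchange_big /= mulnC -sum_nat_const leq_eqVlt; apply/orP; left; apply/eqP.
apply: eq_bigr => e /(subsetP gG); rewrite inE => /eqP <-.
by rewrite -sum1_card [RHS]big_mkcond; apply: eq_bigr => x _; case: (x \in e).
Qed.

(* At most [t] vertices have degree below [D], since [t] of them would miss at least [t] other vertices. *)
Lemma joined_edges k t D (G : {set {set 'I_k}}) : is_graph G -> joined t G ->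
  D.+2 * t <= k -> k * D <= 4 * #|G|.
Proof.
move=> gG jG kt.
pose low := [set x | #|nbr G x| < D].
have lowt : #|low| <= t.
  rewrite leqNgt; apply/negP => /ltnW /exists_subset_card[A Alow At].
  pose N := A :|: \bigcup_(x in A) nbr G x.
  have dAN : [disjoint A & ~: N] by rewrite disjoints_subset setCK subsetUl.
  have cN : #|N| <= t + t * D.
    apply: leq_trans (leq_card_setU _ _) _; rewrite At leq_add2l.
    apply: leq_trans (leq_card_bigcup _ _) _; rewrite -At -sum_nat_const.
    by apply: leq_sum => x /(subsetP Alow); rewrite inE => /ltnW.
  have [||a [b [aA]]] := joinedP jG dAN.
  - by rewrite At.
  - by have := cardsC N; rewrite card_ord; move: cN kt; move: #|N| #|~: N| => a b; nia.
  rewrite !inE negb_or => /andP[_ /negP bN] abG; case: bN.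
  by apply/bigcupP; exists a; rewrite ?inE.
have := sum_degrees gG.
have : (k - #|low|) * D <= \sum_x #|nbr G x|.
  rewrite (bigID (fun x => x \in low)) /=; apply: leq_trans (leq_addl _ _).
  have -> : k - #|low| = #|~: low| by rewrite [RHS]cardsCs setCK card_ord.
  rewrite -sum_nat_const; under eq_bigl do rewrite inE.
  by apply: leq_sum => x; rewrite inE -leqNgt.
by move: lowt kt; move: #|low| #|G| (\sum_x _) => a b c; nia.
Qed.

(** * Hamiltonian paths and isomorphism classes *)

Definition path_graph k : {set {set 'I_k}} :=
  [set [set p.1; p.2] | p : 'I_k * 'I_k & p.2 == p.1.+1 :> nat].

Lemma card_path_graph k : #|path_graph k| <= k.
Proof.
rewrite -[leqRHS]card_ord; apply: leq_trans (leq_imset_card _ _) _.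
rewrite -(card_in_imset (f := fst)); first exact: max_card.
by move=> [a b] [c d]; rewrite !inE /= => /eqP bE /eqP dE ac; congr pair => //;
  apply: val_inj; rewrite /= bE dE ac.
Qed.

(** These are the oriented Hamiltonian paths of [G]: [s] lists the vertices along the path. *)
Definition path_copies k (G : {set {set 'I_k}}) : {set {perm 'I_k}} :=
  [set s : {perm 'I_k} | [forall e in path_graph k, s @: e \in G]].

(* A copy of the path is determined by its first vertex and the successor of each vertex. *)
Lemma card_path_copies k (G : {set {set 'I_k.+1}}) :
  #|path_copies G| <= k.+1 * \prod_x #|nbr G x|.+1.
Proof.
(* The last vertex is its own successor by default, whence degree plus one. *)
pose next (s : {perm 'I_k.+1}) : {ffun 'I_k.+1 -> 'I_k.+1} :=
  [ffun v => if (s^-1 v)%g.+1 < k.+1 then s (inord (s^-1 v)%g.+1) else v].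
pose F v := v |: nbr G v.
have nextE (s : {perm 'I_k.+1}) (i : 'I_k.+1) : i.+1 < k.+1 -> next s (s i) = s (inord i.+1).
  by move=> ik; rewrite ffunE permK ik.
pose code (s : {perm 'I_k.+1}) := (s ord0, next s).
have codeI : injective code.
  move=> s u [s0 /ffunP nx]; apply/permP => i.
  have [m im] := ubnP (val i); elim: m i im => // m IH [[|i] ilt] im.
    by rewrite (_ : Ordinal ilt = ord0) //; apply: val_inj.
  have ilt' : i < k.+1 by apply: ltnW.
  have -> : Ordinal ilt = inord (Ordinal ilt').+1.
    by apply: val_inj; rewrite /= inordK.
  by rewrite -!nextE // nx IH.
rewrite -(card_imset _ codeI).
apply: (@leq_trans #|setX [set: 'I_k.+1] [set f in family F]|).
  apply: subset_leq_card; apply/subsetP => _ /imsetP[s sG ->].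
  rewrite in_setX in_setT inE; apply/familyP => v; rewrite ffunE !inE.
  case: ifP => [vk|_]; last by rewrite eqxx.
  move: sG; rewrite inE => /forall_inP/(_ [set (s^-1)%g v; inord ((s^-1)%g v).+1]).
  rewrite imsetU1 imset_set1 permKV => ->; first by rewrite orbT.
  apply/imsetP; exists ((s^-1)%g v, inord ((s^-1)%g v).+1) => //.
  by rewrite inE /= inordK.
rewrite cardsX cardsT card_ord cardsE card_family leq_mul2l /=.
rewrite foldrE big_map big_enum /=.
by apply: leq_prod => x _; rewrite cardsU1; case: (_ \notin _).
Qed.

(** This is [x.+1 <= 2 ^ (2 + x / 4)] without fractions; over all degrees the quarters add up to at
    most half the number of edges. *)
Lemma exp4_bound x : x.+1 ^ 4 <= 2 ^ (8 + x).
Proof.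
(* Increasing the base by one at most doubles its fourth power only from base 6 on, so smaller cases
   are computed. *)
do 5 (case: x => [|x] //).
elim: x => // x IH; rewrite addnS expnS.
apply: leq_trans (leq_mul (leqnn 2) IH).
by rewrite !expnS !expn0; nia.
Qed.

Lemma path_copies_bound k (G : {set {set 'I_k}}) : 0 < k -> is_graph G ->
  #|path_copies G| ^ 4 <= 2 ^ (12 * k + 2 * #|G|).
Proof.
case: k G => // k G _ gG; apply: (@leq_trans ((k.+1 * \prod_x #|nbr G x|.+1) ^ 4)).
  by rewrite leq_exp2r // card_path_copies.
rewrite expnMn (_ : 12 * k.+1 = k.+1 * 4 + k.+1 * 8); last by lia.
rewrite -addnA expnD leq_mul //.
  by rewrite expnM leq_exp2r // ltnW // ltn_expl.
apply: (@leq_trans (2 ^ (\sum_(x : 'I_k.+1) (8 + #|nbr G x|)))).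
  elim/big_rec2: _ => // x m y _ IH.
  by rewrite expnMn expnD leq_mul // exp4_bound.
rewrite leq_exp2l // big_split /= sum_nat_const card_ord leq_add2l.
exact: sum_degrees.
Qed.

(** Fix [X1] between the path and [H]. An isomorphism [s] from another such [X2] to [X1] carries the
    path into [H], and [X2] is recovered from [s]; so each class holds at most [#|path_copies H|] of
    these graphs. *)
Lemma exp_le_s_k_path_copies k n (G : {set {set 'I_n}}) (H : {set {set 'I_k}}) (f : 'I_k -> 'I_n) :
  injective f -> is_graph H -> path_graph k \subset H ->
  (forall e, e \in H -> f @: e \in G) ->
  2 ^ (#|H| - k) <= s_k k G * #|path_copies H|.
Proof.
move=> fi gH PH fG.
pose Fam := [set path_graph k :|: X | X : {set {set 'I_k}} in powerset (H :\: path_graph k)].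
have FamP X : X \in Fam -> path_graph k \subset X /\ X \subset H.
  case/imsetP => Y; rewrite inE => YH ->; split; first exact: subsetUl.
  by rewrite subUset PH (subset_trans YH) // subsetDl.
have Famsub X : X \in Fam -> X \in sub_graphs k G.
  move=> /FamP[_ XH]; rewrite inE /is_graph (subset_trans XH gH) /=.
  apply/existsP; exists (finfun f); apply/andP; split.
    by apply/injectiveP => x y; rewrite !ffunE; apply: fi.
  apply/forall_inP => e /(subsetP XH) /fG.
  by rewrite [in X in _ -> X](eq_imset (g := f)) // => x; rewrite ffunE.
have cFam : #|Fam| = 2 ^ #|H :\: path_graph k|.
  rewrite card_in_imset ?card_powerset // => X Y; rewrite !inE !subsetD.
  move=> /andP[_ dX] /andP[_ dY] /(congr1 (fun Z => Z :\: path_graph k)).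
  by rewrite !setDUl setDv !set0U !(setDidPl _).
apply: (@leq_trans #|Fam|).
  rewrite cFam leq_exp2l // (cardsDS PH); apply: leq_sub2l; exact: card_path_graph.
rewrite /s_k mulnC; set classes := [set _ | _ in _].
apply: (@leq_trans #|\bigcup_(K in classes) (K :&: Fam)|).
  apply: subset_leq_card; apply/subsetP => X XF; apply/bigcupP.
  exists [set H' in sub_graphs k G | graph_iso X H'].
    by apply/imsetP; exists X => //; apply: Famsub.
  by rewrite inE XF inE Famsub //= graph_iso_refl.
apply: leq_trans (leq_card_bigcup _ _) _.
rewrite mulnC -sum_nat_const; apply: leq_sum => _ /imsetP[X0 _ ->].
case: (set_0Vmem ([set H' in sub_graphs k G | graph_iso X0 H'] :&: Fam)) => [->|[X1]].
  by rewrite cards0.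
rewrite !inE => /andP[/andP[_ iso01] /FamP[_ X1H]].
apply: leq_trans (leq_imset_card (fun s : {perm 'I_k} =>
  [set (s^-1)%g @: e | e : {set 'I_k} in X1]) (path_copies H)).
apply: subset_leq_card; apply/subsetP => X2.
rewrite !inE => /andP[/andP[_ iso02] /FamP[PX2 _]].
have /graph_isoP[s sE] : graph_iso X2 X1.
  by apply: graph_iso_trans iso01; rewrite graph_iso_sym.
apply/imsetP; exists s.
  rewrite inE; apply/forall_inP => e /(subsetP PX2) eX2.
  by apply: (subsetP X1H); rewrite -sE; apply/imsetP; exists e.
rewrite -sE relabel_comp (eq_imset (g := id)) ?imset_id // => e.
by rewrite (eq_imset (g := id)) ?imset_id // => x; rewrite /= permK.
Qed.

Lemma joined_lower_bound n t a (G : {set {set 'I_n}}) :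
  0 < t -> is_graph G -> joined t G -> (36 + 8 * a) * t <= n ->
  exists2 k, 0 < k <= n & 2 ^ (a * k) <= s_k k G.
Proof.
move=> t0 gG jG nt; have [p [up sp szp]] := joined_path jG.
pose k := size p.
have kn : k <= n by rewrite /k -[X in _ <= X]card_ord -(card_uniqP up) max_card.
(* [D.+2 + 2] is [36 + 8 * a], which leaves room for the [2 * t] vertices off the path. The
   resulting [2 * #|H| >= (16 + 4 * a) * k] is what the final comparison uses. *)
pose D := 2 * (16 + 4 * a).
have kD : D.+2 * t <= k by rewrite /D; nia.
have k0 : 0 < k by nia.
pose x0 : 'I_n := Ordinal (leq_trans k0 kn).
exists k; first by rewrite k0.
pose f (i : 'I_k) := nth x0 p i.
have fi : injective f by move=> i j /eqP; rewrite nth_uniq // => /eqP/val_inj.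
(* The graph induced on the path, relabelled by positions so that it contains [path_graph k]. *)
pose H := [set e in pairs k | f @: e \in G].
have gH : is_graph H by apply/subsetP => e; rewrite inE => /andP[].
have fG e : e \in H -> f @: e \in G by rewrite inE => /andP[].
have inH x y : ([set x; y] \in H) = ([set f x; f y] \in G).
  rewrite inE imsetU1 imset_set1 andb_idl // => /(subsetP gG).
  by rewrite !inE !cards2 (inj_eq fi).
have PH : path_graph k \subset H.
  apply/subsetP => _ /imsetP[[i j] + ->]; rewrite inE /= => /eqP ij.
  by rewrite inH /f ij; move/(sortedP x0): sp; apply; rewrite -ij.
have jH : joined t H.
  apply/forallP => A; apply/forallP => B; apply/implyP => /and3P[dAB tA tB].
  have [|||_ [_ [/imsetP[x xA ->] /imsetP[y yB ->] xyG]]] :=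
    @joinedP n t G (f @: A) (f @: B) jG; rewrite ?card_imset //.
    rewrite -setI_eq0 -imsetI; last by move=> ? ? _ _; apply: fi.
    by move: dAB; rewrite -setI_eq0 => /eqP ->; rewrite imset0.
  by apply/exists_inP; exists x => //; apply/exists_inP; exists y; rewrite ?inH.
have edges := joined_edges gH jH kD.
have cnt := exp_le_s_k_path_copies fi gH PH fG.
have cop : #|path_copies H| ^ 4 <= 2 ^ (12 * k + 2 * #|H|).
  exact: path_copies_bound.
(* Fourth powers match [path_copies_bound]; the truncated [#|H| - k] is exact because [edges] gives
   [k <= #|H|]. *)
have {}cnt : 2 ^ (4 * #|H|) <= s_k k G ^ 4 * 2 ^ (16 * k + 2 * #|H|).
  have -> : 4 * #|H| = (#|H| - k) * 4 + 4 * k.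
    by move: edges; rewrite /D; move: #|H| => h; nia.
  have -> : 16 * k + 2 * #|H| = 12 * k + 2 * #|H| + 4 * k by lia.
  have shift u v w s : 2 ^ u <= s * 2 ^ v -> 2 ^ (u + w) <= s * 2 ^ (v + w).
    by move=> uv; rewrite !expnD mulnA leq_mul.
  apply: shift; rewrite expnM.
  apply: (@leq_trans ((s_k k G * #|path_copies H|) ^ 4)); first by rewrite leq_exp2r.
  by rewrite expnMn leq_mul.
rewrite -(leq_exp2r _ _ (isT : 0 < 4)) -expnM.
rewrite -(@leq_pmul2r (2 ^ (16 * k + 2 * #|H|))) ?expn_gt0 //.
apply: leq_trans cnt; rewrite -expnD leq_exp2l //.
by move: edges; rewrite /D; move: #|H| => h; nia.
Qed.

(** * Unjoined pairs in G(n, p) and the lower bound *)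

Section LowerBound.
Variable R : realType.
Local Open Scope ring_scope.

Definition cross_pairs n (A B : {set 'I_n}) : {set {set 'I_n}} :=
  [set [set q.1; q.2] | q in setX A B].

Lemma card_cross_pairs n (A B : {set 'I_n}) : [disjoint A & B] ->
  #|cross_pairs A B| = (#|A| * #|B|)%N.
Proof.
move=> dAB; rewrite card_in_imset ?cardsX // => -[a b] [c d]; rewrite !inE /=.
move=> /andP[aA bB] /andP[cA dB] eqs.
have neq x y : x \in A -> y \in B -> x != y.
  by move=> xA yB; apply: contraTneq yB => <-; rewrite (disjointFr dAB).
have /set2P[->|ad] : a \in [set c; d] by rewrite -eqs set21.
  have /set2P[bc|-> //] : b \in [set c; d] by rewrite -eqs set22.
  by move: (neq c b cA bB); rewrite bc eqxx.
by move: (neq a d aA dB); rewrite ad eqxx.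
Qed.

Lemma cross_pairs_graph n (A B : {set 'I_n}) : [disjoint A & B] ->
  is_graph (cross_pairs A B).
Proof.
move=> dAB; apply/subsetP => _ /imsetP[[a b] + ->]; rewrite !inE /= => /andP[aA bB].
rewrite cards2; suff -> : a != b by [].
by apply: contraTneq bB => <-; rewrite (disjointFr dAB).
Qed.

Definition unjoined_count n t (E : {set {set 'I_n}}) : R :=
  \sum_(P : {set 'I_n} * {set 'I_n} | [&& [disjoint P.1 & P.2], t <= #|P.1| & t <= #|P.2|]%N)
    [disjoint E & cross_pairs P.1 P.2]%:R.

Lemma unjoined_count_ge1 n t (E : {set {set 'I_n}}) :
  ~~ joined t E -> 1 <= unjoined_count t E.
Proof.
case/forallPn => A /forallPn[B]; rewrite negb_imply => /andP[AB noE].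
rewrite /unjoined_count (bigD1 (A, B)) //= (_ : [disjoint _ & _]) ?lerDl ?sumr_ge0 //.
rewrite disjoint_sym disjoints_subset; apply/subsetP => _ /imsetP[[a b] + ->].
rewrite !inE /= => /andP[aA bB]; apply: contra noE => abE.
by apply/exists_inP; exists a => //; apply/exists_inP; exists b.
Qed.

(** There are at most [4 ^+ n] pairs of sets, and each must miss at least [t * t] edges. *)
Lemma unjoined_mean n t (p : R) : 0 <= p <= 1 ->
  gnp_mean p (@unjoined_count n t) <= 4 ^+ n * expR (- p) ^+ (t * t).
Proof.
move=> /andP[p0 p1]; rewrite /unjoined_count gnp_mean_sum.
have -> : 4 ^+ n * expR (- p) ^+ (t * t) =
    \sum_(P : {set 'I_n} * {set 'I_n}) expR (- p) ^+ (t * t) :> R.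
  rewrite sumr_const card_prod -cardsT -powersetT card_powerset cardsT card_ord.
  by rewrite -[RHS]mulr_natl natrM !natrX -exprMn -natrM.
rewrite [leRHS](bigID (fun P : {set 'I_n} * {set 'I_n} =>
  [&& [disjoint P.1 & P.2], t <= #|P.1| & t <= #|P.2|]%N)) /=.
apply: ler_wpDr; first by apply: sumr_ge0 => P _; rewrite exprn_ge0 // expR_ge0.
apply: ler_sum => -[A B] /= /and3P[dAB tA tB].
rewrite -(gnp_mean_prob p (fun E => [disjoint E & cross_pairs A B])).
rewrite gnp_prob_disjoint ?cross_pairs_graph // card_cross_pairs //.
have q1 : 1 - p <= expR (- p) by rewrite expR_ge1Dx.
apply: (@le_trans _ _ ((1 - p) ^+ (t * t))).
  by rewrite ler_wiXn2l ?subr_ge0 ?gerBl // leq_mul.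
by rewrite lerXn2r ?nnegrE ?subr_ge0 ?expR_ge0.
Qed.

Lemma whp_not_tiny (c : R) : 0 < c -> exists d : R, 0 <= d /\
  whp d (fun n G => ~~ monotone_tiny c G).
Proof.
move=> c0; pose a := Num.bound c.
have ca : c < 2 ^+ a.
  apply: lt_trans (archi_boundP (ltW c0)) _.
  by rewrite -natrX ltr_nat ltn_expl.
pose q := (36 + 8 * a)%N; have q0 : (0 < q)%N by [].
(* With [n <= 2 * q * t], the [4 ^+ n] pairs cost at most [16 ^+ q] per unit of [t], and [d] yields
   a factor [expR (- D)] per unit. As [D <= expR D], the quotient is at most one half. *)
pose D : R := 2 * (4 ^+ 2) ^+ q.
have D0 : 0 <= D by rewrite mulr_ge0 ?exprn_ge0.
pose d : R := 2 * q%:R * D.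
have d0 : 0 <= d by rewrite mulr_ge0 // mulr_ge0 // ler0n.
exists d; split => //.
apply: (@whp_of_mean R d _ (fun n => @unjoined_count n (n %/ q)) q (fun n => 2 ^- (n %/ q))) => //.
- move=> n E nq gE; rewrite negbK => tiny; apply: unjoined_count_ge1.
  apply: contraL tiny => jE.
  have [||k /andP[k0 kn] sk] := @joined_lower_bound n (n %/ q) a E _ gE jE.
  + by rewrite divn_gt0.
  + by rewrite mulnC leq_trunc_div.
  apply/allPn; exists k; first by rewrite mem_iota k0 add1n ltnS.
  rewrite -ltNge; apply: (@lt_le_trans _ _ ((2 ^ (a * k))%:R)); last by rewrite ler_nat.
  by rewrite natrX exprM ltrXn2r ?exprn_ge0 ?(ltW c0) // -lt0n.
- by move=> n E; apply: sumr_ge0.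
- move=> n nq dn; have n0 : 0 < n%:R :> R by rewrite ltr0n (leq_trans _ nq).
  set t := (n %/ q)%N; have t0 : (0 < t)%N by rewrite divn_gt0.
  (* [n < q * t.+1], and [t.+1 <= 2 * t] since [t] is positive. *)
  have nt : (n <= 2 * q * t)%N.
    by apply: ltnW (leq_trans (ltn_ceil n q0) _); rewrite -/t; nia.
  have p01 : 0 <= d / n%:R <= 1 by rewrite divr_ge0 ?(ltW n0) //= ler_pdivrMr // mul1r.
  apply: le_trans (unjoined_mean n t p01) _.
  have step : expR (- (d / n%:R)) ^+ t <= (expR D)^-1.
    rewrite -expRM_natl -expRN ler_expR mulrN lerN2 mulrA ler_pdivlMr //.
    rewrite (_ : t%:R * d = (2 * q * t)%:R * D); last by rewrite /d !natrM; ring.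
    by rewrite mulrC ler_wpM2r // ler_nat.
  rewrite exprM.
  apply: (@le_trans _ _ (((4 ^+ 2) ^+ q) ^+ t * (expR D)^-1 ^+ t)).
    apply: ler_pM; rewrite ?exprn_ge0 ?expR_ge0 //.
      by rewrite -!exprM; apply: ler_weXn2l; rewrite ?ler1n ?mulnA.
    by rewrite lerXn2r ?nnegrE ?exprn_ge0 ?invr_ge0 ?expR_ge0.
  have W0 : 0 <= (4 ^+ 2) ^+ q :> R by rewrite exprn_ge0 // exprn_ge0.
  rewrite -exprMn -exprVn; apply: lerXn2r; rewrite ?nnegrE ?invr_ge0 //.
    by rewrite divr_ge0 ?expR_ge0.
  rewrite ler_pdivrMr ?expR_gt0 //.
  have : D <= expR D by apply: le_trans (expR_ge1Dx D); rewrite lerDr.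
  by rewrite {1}/D; move: (expR D) ((4 ^+ 2) ^+ q) => x y; lra.
- move=> eps eps0; exists (q * (Num.bound eps^-1).+1)%N => n nN.
  rewrite invf_plt ?posrE ?exprn_gt0 //; apply: lt_trans (archi_boundP _) _.
    by rewrite invr_ge0 ltW.
  have bn : (Num.bound eps^-1 < n %/ q)%N by rewrite leq_divRL // mulnC.
  by rewrite -natrX ltr_nat (leq_trans bn) // ltnW // ltn_expl.
Qed.

End LowerBound.

Local Open Scope ring_scope.

Theorem theorem1p3 (R : realType) :
  (forall d1 : R, 0 <= d1 -> exists c : R, 0 < c /\
     whp d1 (fun n G => monotone_tiny c G))
  /\
  (forall c : R, 0 < c -> exists d2 : R, 0 <= d2 /\
     whp d2 (fun n G => ~~ monotone_tiny c G)).
Proof. by split=> [d|c]; [apply: whp_tiny | apply: whp_not_tiny]. Qed.
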